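(* Let $F\subseteq\mathbb{R}^n$, $f\colon\mathbb{R}^n\to\mathbb{R}$, and let $(\mathcal{C},\mathcal{D},g,z,\mathcal{T},\epsilon)$ be an $(F,f)$-valid configuration. Let $C\subseteq\mathbb{R}^n$ and $\mathcal{A}\subseteq\mathcal{P}(\mathbb{R}^n)$. If $$C\supseteq\bigcap(\mathcal{C}\cup\mathcal{D}\cup\mathcal{A})\cap\{x\in\mathbb{R}^n: g(x)<z\},$$ then the configuration $(\mathcal{C},\mathcal{D}\cup\{[\mathcal{A}\rightsquigarrow C]\},g,z,\mathcal{T},\epsilon)$ is also $(F,f)$-valid.
   Context: Constraints are arbitrary subsets of $\mathbb{R}^n$. For $\mathcal{C}\subseteq\mathcal{P}(\mathbb{R}^n)$ (power set) write $\bigcap\mathcal{C}=\bigcap_{C\in\mathcal{C}}C$, with $\bigcap\emptyset=\mathbb{R}^n$. For $\mathcal{A}\subseteq\mathcal{P}(\mathbb{R}^n)$ and $C\subseteq\mathbb{R}^n$, the implication constraint is the set $[\mathcal{A}\rightsquigarrow C]=(\mathbb{R}^n\setminus\bigcap\mathcal{A})\cup C$. For a list $\tau=(i_1,\dots,i_k)\in\{\pm1,\dots,\pm n\}^k$ write $\tau(x)=(\mathrm{sgn}(i_1)x_{|i_1|},\dots,\mathrm{sgn}(i_k)x_{|i_k|})\in\mathbb{R}^k$ for $x\in\mathbb{R}^n$ and $\tau(C)=\{\tau(x):x\in C\}$ for $C\subseteq\mathbb{R}^n$; the empty list is allowed. For another list $\tau'=(i'_1,\dots,i'_{k'})$, write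 $\tau\trianglelefteq\tau'$ if $k\le k'$ and $i_j=i'_j$ for all $1\le j\le k$. For a node $v$ of a directed graph, $\delta^+(v)$ is its set of children. Branching tree: a tuple $\mathcal{T}=(V,E,B,\sigma)$ is a $\mathcal{C}$-consistent branching tree if: (T1) $(V,E)$ is an arborescence with $1\le|V|<\infty$ and root $r\in V$. (T2) Each $v\in V$ has a branching constraint $B_v\subseteq\mathbb{R}^n$, and $B_r=\mathbb{R}^n$. (T3) For all $u\in V$ with $\delta^+(u)\ne\emptyset$: $\bigcap\mathcal{C}\subseteq\bigcup_{v\in\delta^+(u)}B_v$. (T4) Each $v\in V$ has a list $\sigma_v\in\{\pm1,\dots,\pm n\}^{\ell_v}$, $\ell_v\in\{0,\dots,n\}$, with $|(\sigma_v)_1|,\dots,|(\sigma_v)_{\ell_v}|$ pairwise distinct. (T5) $\sigma_u\trianglelefteq\sigma_v$ for all $u\in V$, $v\in\delta^+(u)$. (T6) For all $v\in V$ and $1\le i\le\ell_v$: $\max\{\sigma_v(x)_i:x\in\bigcap\mathcal{C}\}<\infty$ (i.e. the set is bounded above). (T7) For all $u\in V$ and $v\ne w$ in $\delta^+(u)$: $\sigma_u(B_v)\cap\sigma_u(B_w)=\emptyset$. Relations: for $v\in V$ let $\mathcal{B}_v=\{B_u: u \text{ is a node on the } r\text{-}v\text{-path in } \mathcal{T}\}$. For $x,y\in\bigcap\mathcal{C}$ let $\mathrm{dcn}(x,y)$ be the deepest node $w\in V$ with $x,y\in\bigcap(\mathcal{C}\cup\mathcal{B}_w)$. For $\epsilon>0$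 and $a,b\in\mathbb{R}^k$, let $a\succ_\epsilon b$ mean $a\neq b$ and $a_i\ge b_i+\epsilon$ for the smallest index $i$ with $a_i\ne b_i$. For $x,y\in\bigcap\mathcal{C}$ and $v=\mathrm{dcn}(x,y)$: $x\succeq_{\epsilon,\mathcal{T}}y$ iff $\sigma_v(x)=\sigma_v(y)$ or $\sigma_v(x)\succ_\epsilon\sigma_v(y)$; $x\succ_{\epsilon,\mathcal{T}}y$ iff $\sigma_v(x)\succ_\epsilon\sigma_v(y)$. Configuration: let $F\subseteq\mathbb{R}^n$, $f\colon\mathbb{R}^n\to\mathbb{R}$. A configuration $(\mathcal{C},\mathcal{D},g,z,\mathcal{T},\epsilon)$ with $\mathcal{C},\mathcal{D}\subseteq\mathcal{P}(\mathbb{R}^n)$, $g\colon\mathbb{R}^n\to\mathbb{R}$, $z\in\mathbb{R}\cup\{\infty\}$, $\mathcal{T}$ a branching tree and $\epsilon$ a real number is $(F,f)$-valid if: (V1) $\mathcal{T}$ is $\mathcal{C}$-consistent and $\epsilon>0$. (V2) If $z<\infty$, there exists $x\in F$ with $f(x)\le z$. (V3) For all real $\hat z<z$, there exists $x\in F$ with $f(x)\le\hat z$ if and only if there exists $x\in\bigcap\mathcal{C}$ with $g(x)\le\hat z$. (V4) For every $x\in\bigcap\mathcal{C}$ with $g(x)<z$ there exists $y\in\bigcap(\mathcal{C}\cup\mathcal{D})$ with $y\succeq_{\epsilon,\mathcal{T}}x$ and $g(y)\le g(x)$. *)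

(* Defs.v *)
From HB Require Import structures.
From mathcomp Require Import all_boot all_order all_algebra.
From mathcomp Require Import mathcomp_extra boolp classical_sets reals
  constructive_ereal.

Set Implicit Arguments.
Unset Strict Implicit.
Unset Printing Implicit Defensive.

Import Order.TTheory GRing.Theory Num.Theory.

Local Open Scope classical_set_scope.
Local Open Scope ring_scope.

Definition constraint (R : realType) (n : nat) := set 'rV[R]_n.

(* As an intersection over a family of sets, [inter set0] is [setT]. *)
Definition inter (R : realType) (n : nat) (CC : set (constraint R n)) :
    constraint R n :=
  \bigcap_(X in CC) X.

Definition implication (R : realType) (n : nat) (AA : set (constraint R n))
    (C : constraint R n) : constraint R n :=
  ~` inter AA `|` C.

(* The signed index +(i+1) is encoded as (false, i), and -(i+1) as (true, i),
   so the sign is (-1) ^+ s.1. *)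
Definition signed_index (n : nat) : Type := (bool * 'I_n)%type.

Definition act (R : realType) (n : nat) (tau : seq (signed_index n))
    (x : 'rV[R]_n) : 'rV[R]_(size tau) :=
  \row_(j < size tau)
    let s := tnth (in_tuple tau) j in (-1) ^+ s.1 * x ord0 s.2.

Record branching_tree (R : realType) (n : nat) := BranchingTree {
  node : finType;
  edge : rel node;
  tree_root : node;
  branch : node -> constraint R n;
  sigma : node -> seq (signed_index n)
}.

Arguments edge {R n} b.
Arguments tree_root {R n} b.
Arguments branch {R n} b.
Arguments sigma {R n} b.

(* Unique directed walk from the root to every node, the root included: this
   excludes directed cycles and edges into the root. *)
Definition arborescence (V : finType) (e : rel V) (r : V) : Prop :=
  forall v : V, exists! p : seq V, path e r p /\ last r p = v.

Section Tree.
Context (R : realType) (n : nat) (T : branching_tree R n).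

Definition children (u : node T) : set (node T) := [set v | edge T u v].

(* The r-v-path without its first node r; it is the only candidate when the
   tree is an arborescence. *)
Definition root_path (v : node T) : seq (node T) :=
  xget [::] [set p | path (edge T) (tree_root T) p /\ last (tree_root T) p = v].

Definition depth (v : node T) : nat := size (root_path v).

Definition path_constraints (v : node T) : set (constraint R n) :=
  [set branch T u | u in [set u | u \in tree_root T :: root_path v]].

(* In the boundedness clause, the supremum of an empty set counts as finite. *)
Record consistent (CC : set (constraint R n)) : Prop := Consistent {
  tree_arborescence : arborescence (edge T) (tree_root T);
  branch_root : branch T (tree_root T) = setT;
  branch_cover : forall u, children u !=set0 ->
    inter CC `<=` \bigcup_(v in children u) branch T v;
  sigma_size : forall v, (size (sigma T v) <= n)%N;
  sigma_uniq : forall v, uniq [seq s.2 | s <- sigma T v];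
  sigma_prefix : forall u v, children u v -> prefix (sigma T u) (sigma T v);
  sigma_bounded : forall v (i : 'I_(size (sigma T v))),
    has_ubound [set act (sigma T v) x ord0 i | x in inter CC];
  branch_disjoint : forall u v w,
    children u v -> children u w -> v <> w ->
    (act (sigma T u) @` branch T v) `&` (act (sigma T u) @` branch T w) = set0
}.

Definition common_node (CC : set (constraint R n)) (x y : 'rV[R]_n)
    (w : node T) : Prop :=
  inter (CC `|` path_constraints w) x /\ inter (CC `|` path_constraints w) y.

(* For x, y in [inter CC] and a consistent tree, the root is a common node and
   the deepest common node is unique. *)
Definition dcn (CC : set (constraint R n)) (x y : 'rV[R]_n) : node T :=
  [arg max_(w > tree_root T | `[< common_node CC x y w >]) depth w]%N.

End Tree.

Definition lex_gt (R : realType) (k : nat) (eps : R) (a b : 'rV[R]_k) : Prop :=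
  a <> b /\
  exists i : 'I_k,
    [/\ a ord0 i <> b ord0 i,
        forall j : 'I_k, (j < i)%N -> a ord0 j = b ord0 j
      & b ord0 i + eps <= a ord0 i].

(* Meant for x and y in [inter CC]. *)
Definition tree_ge (R : realType) (n : nat) (CC : set (constraint R n))
    (eps : R) (T : branching_tree R n) (x y : 'rV[R]_n) : Prop :=
  let v := dcn T CC x y in
  act (sigma T v) x = act (sigma T v) y \/
  lex_gt eps (act (sigma T v) x) (act (sigma T v) y).

(* The bound z ranges over reals and +oo. *)
Record valid (R : realType) (n : nat) (F : set 'rV[R]_n) (f : 'rV[R]_n -> R)
    (CC DD : set (constraint R n)) (g : 'rV[R]_n -> R) (z : \bar R)
    (T : branching_tree R n) (eps : R) : Prop := Valid {
  valid_tree : consistent T CC;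
  valid_eps : 0 < eps;
  valid_incumbent : (z < +oo)%E -> exists2 x, F x & ((f x)%:E <= z)%E;
  valid_core : forall zh : R, (zh%:E < z)%E ->
    (exists2 x, F x & f x <= zh) <-> (exists2 x, inter CC x & g x <= zh);
  valid_derived : forall x, inter CC x -> ((g x)%:E < z)%E ->
    exists y, [/\ inter (CC `|` DD) y, tree_ge CC eps T y x & g y <= g x]
}.

(* Main.v *)
Require Import Defs.
From HB Require Import structures.
From mathcomp Require Import all_boot all_order all_algebra.
From mathcomp Require Import mathcomp_extra boolp classical_sets reals
  constructive_ereal.

Set Implicit Arguments.
Unset Strict Implicit.
Unset Printing Implicit Defensive.

Import Order.TTheory GRing.Theory Num.Theory.

Local Open Scope classical_set_scope.
Local Open Scope ring_scope.

(** The new constraint removes no witness of the derived-constraint clause.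
    The other clauses do not mention the derived constraints.  Given [x] of
    value below [z], the old configuration supplies [y] above [x] in the tree
    preorder with [g y <= g x < z].  This same [y] satisfies the implication:
    if it satisfies all premises in [AA], then it lies in the set that [C] is
    assumed to contain; otherwise the implication holds vacuously. *)

Theorem theorem3 (R : realType) (n : nat) (F : set 'rV[R]_n)
  (f : 'rV[R]_n -> R) (CC DD : set (constraint R n)) (g : 'rV[R]_n -> R)
  (z : \bar R) (hz : z <> -oo%E) (T : branching_tree R n) (eps : R)
  (hvalid : valid F f CC DD g z T eps)
  (C : constraint R n) (AA : set (constraint R n))
  (hC : inter (CC `|` DD `|` AA) `&` [set x | ((g x)%:E < z)%E] `<=` C) :
  valid F f CC (DD `|` [set implication AA C]) g z T eps.
Proof.
case: hvalid => tree_ok eps_gt0 incumbent core derived; split=> // x Cx gx_ltz.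
have [y [CDy y_ge_x gy_le]] := derived x Cx gx_ltz.
exists y; split=> // X [CX|[DX|->]]; [by apply: CDy; left|by apply: CDy; right|].
have [AAy|nAAy] := pselect (inter AA y); last by left.
right; apply: hC; split; first by move=> Y [/CDy|/AAy].
by apply: le_lt_trans gx_ltz; rewrite lee_fin.
Qed.
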